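(* Let $h$ be any well-posedness growth bound and let $\zeta\ge h$ be any growth bound for which $\zeta/h$ and $\zeta h$ are also growth bounds. Let $u_1^0,u_2^0\in S_h$ and let $\omega_1^0,\omega_2^0$ be the corresponding initial vorticities. Assume that there exist solutions $u_1,u_2$ to the Euler equations in $S_h$ on $[0,T]$ with initial velocities $u_1^0,u_2^0$, and let $X_1,X_2$ be the corresponding flow maps. Let $$a(T):=\|(u_1^0-u_2^0)/\zeta\|_{L^\infty(\mathbb{R}^2)}+\|J/\zeta\|_{L^\infty((0,T)\times\mathbb{R}^2)},$$ where $$J(t,x)=\Bigl((a_{h(x)}K)*\bigl((\omega_1^0-\omega_2^0)\circ X_1^{-1}(t)\bigr)\Bigr)(x)-\Bigl((a_{h(x)}K)*(\omega_1^0-\omega_2^0)\Bigr)(X_1(t,x)).$$ Then $$a(T)\le C\,\|u_1^0-u_2^0\|_{S_\zeta}.$$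
   Context: $C$ denotes a generic positive constant; no further dependence is specified in the statement. ''Increasing'' means nondecreasing. A pre-growth bound is a function $h:[0,\infty)\to(0,\infty)$ that is concave, increasing, differentiable on $[0,\infty)$, and twice continuously differentiable on $(0,\infty)$. A growth bound is a pre-growth bound $h$ with $\int_1^\infty h(s)s^{-2}\,ds<\infty$. A well-posedness growth bound is a growth bound $h$ for which $h^2$ is also a growth bound. For $x\in\mathbb{R}^2$ write $h(x)=h(|x|)$, $\zeta(x)=\zeta(|x|)$. For a growth bound $h$, $S_h$ is the Banach space of divergence-free vector fields $u$ on $\mathbb{R}^2$ for which $u/h$ and $\omega(u)=\operatorname{curl}u:=\partial_1u^2-\partial_2u^1$ are bounded, with norm $\|u\|_{S_h}=\|u/h\|_{L^\infty}+\|\omega(u)\|_{L^\infty}$; similarly $S_\zeta$. $a\in C_c^\infty(\mathbb{R}^2)$ is a radial cutoff function: radially symmetric, values in $[0,1]$, supported in $\overline{B_1(0)}$, $a\equiv1$ on $\overline{B_{1/2}(0)}$; $a_\lambda(x)=a(x/\lambda)$. (The function $a$ is not to be confused with the number $a(T)$.) $K(x)=(2\pi)^{-1}x^\perp|x|^{-2}$ with $x^\perp=(-x_2,x_1)$; $\nabla^\perp=(-\partial_2,\partial_1)$; for matrix-valued $A,B$, $A\mathop{*\cdot}B=\sum_{i,k}A^{ik}*B^{ik}$, where $*$ is convolution on $\mathbb{R}^2$. In $J$, the convolutions are computed with the kernel $a_\lambda K$ for fixed $\lambda=h(x)$ and then evaluated at the indicated point. Solution: Fix $T>0$. Let $u\in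 C(0,T;S_h)$ (that is, $u\in C([0,T];S_h)$), let $\omega=\operatorname{curl}u$, and let $X$ be the unique flow map for $u$, $X(t,x)=x+\int_0^tu(s,X(s,x))\,ds$ (which exists). Then $u$ is a solution to the (unforced 2D) Euler equations in $S_h$ on $[0,T]$ with initial velocity $u^0=u|_{t=0}\in S_h$ if (1) $\omega=\omega^0\circ X^{-1}$ on $[0,T]\times\mathbb{R}^2$, where $\omega^0=\operatorname{curl}u^0$; and (2) Serfati's identity holds for all $\lambda>0$ ($t\in[0,T]$, $j=1,2$): $$u^j(t)-(u^0)^j=(a_\lambda K^j)*(\omega(t)-\omega^0)-\int_0^t\bigl(\nabla\nabla^\perp[(1-a_\lambda)K^j]\bigr)\mathop{*\cdot}(u\otimes u)(s)\,ds.$$ *)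

(* Defs.v *)
From HB Require Import structures.
From mathcomp Require Import all_boot all_order all_algebra.
From mathcomp Require Import all_classical all_reals all_analysis.

Set Implicit Arguments.
Unset Strict Implicit.
Unset Printing Implicit Defensive.

Import Order.TTheory GRing.Theory Num.Theory.
Import numFieldNormedType.Exports.

Local Open Scope classical_set_scope.
Local Open Scope ring_scope.

(* The library norm on R * R is the maximum norm; the Euclidean norm is enorm.
   The two coordinates of the plane are indexed by 0, 1 : 'I_2. *)
Notation leb2 := (lebesgue_measure \x lebesgue_measure)%E.

Section Plane.
Variable R : realType.
Implicit Types (f g : R * R -> R) (v : R * R -> R * R) (x y : R * R).
Implicit Types (i j k : 'I_2).

Definition enorm x : R := Num.sqrt (x.1 ^+ 2 + x.2 ^+ 2).

Definition component i x : R := if i == 0 then x.1 else x.2.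

Definition basis_vec i : R * R := ((i == 0)%:R, (i == 1)%:R).

Definition partial i f : R * R -> R := fun x => 'D_(basis_vec i) f x.

Definition gradperp k f : R * R -> R :=
  if k == 0 then \- partial 1 f else partial 0 f.

Definition grad_gradperp f i k : R * R -> R := partial i (gradperp k f).

Fixpoint Ck (n : nat) f : Prop :=
  if n is m.+1 then
    forall i, (forall x, derivable f x (basis_vec i)) /\ Ck m (partial i f)
  else continuous f.

(* Ck requires continuity only at the last order: C^1 functions are continuous,
   so Ck n.+1 entails Ck n. *)
Definition smooth f : Prop := forall n, Ck n f.

Definition test_function f : Prop :=
  smooth f /\ exists r : R, forall x, r < enorm x -> f x = 0.

Definition convolution f g : R * R -> R :=
  fun x => \int[leb2]_y (f (x - y) * g y).

Definition matrix_convolution (A B : 'I_2 -> 'I_2 -> R * R -> R) : R * R -> R :=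
  fun x => \sum_i \sum_k convolution (A i k) (B i k) x.

Definition tensor v w i k : R * R -> R := fun x => component i (v x) * component k (w x).

Definition div_free v : Prop :=
  forall phi, test_function phi ->
    \int[leb2]_x ((v x).1 * partial 0 phi x + (v x).2 * partial 1 phi x) = 0.

(* w represents the distributional curl d_1 v^2 - d_2 v^1 in L^1_loc. *)
Definition is_curl v (w : R * R -> R) : Prop :=
  [/\ measurable_fun setT w,
      forall r : R, leb2.-integrable [set x | enorm x <= r] (EFin \o w) &
      forall phi, test_function phi ->
        \int[leb2]_x (w x * phi x) =
        \int[leb2]_x ((v x).1 * partial 1 phi x - (v x).2 * partial 0 phi x)].

(* A representative of the curl, which is unique up to null sets. *)
Definition curl v : R * R -> R := xget (cst 0) [set w | is_curl v w].

End Plane.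

Section GrowthBound.
Variable R : realType.
Implicit Type h : R -> R.

(* Only the values of h on [0, +oo[ matter. *)
Definition pre_growth_bound h : Prop :=
  [/\ forall r, 0 <= r -> 0 < h r,
      convex_function (`[0, +oo[ : set R) (fun r => - h r),
      forall r s, 0 <= r -> r <= s -> h r <= h s,
      cvg ((fun r => (h r - h 0) / r) @ 0^'+) &
      forall r, 0 < r -> [/\ derivable h r 1, derivable (derive1 h) r 1 &
                            {for r, continuous (derive1n 2 h)}]].

Definition growth_bound h : Prop :=
  pre_growth_bound h /\
  (\int[lebesgue_measure]_(s in `[1%R, +oo[) (h s / s ^+ 2)%:E < +oo)%E.

Definition wp_growth_bound h : Prop :=
  growth_bound h /\ growth_bound (fun r => h r ^+ 2).

End GrowthBound.

Section Serfati.
Variable R : realType.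
Implicit Types (h : R -> R) (v vin : R * R -> R * R) (u X : R -> R * R -> R * R).

Definition weighted_norm h v : \bar R :=
  'N[leb2]_+oo[(fun x => (enorm (v x) / h (enorm x))%:E)]%E.

Definition S_norm h v : \bar R :=
  (weighted_norm h v + 'N[leb2]_+oo[EFin \o curl v])%E.

(* A field in S_h has a unique continuous representative; it is the one used,
   as flow maps need pointwise values. *)
Definition in_S h v : Prop :=
  [/\ continuous v, div_free v, (exists w, is_curl v w) & (S_norm h v < +oo)%E].

Definition in_CS h (T : R) u : Prop :=
  forall t, t \in `[0, T] ->
    in_S h (u t) /\
    S_norm h (fun x => u s x - u t x) @[s --> within `[0, T] (nbhs t)] --> 0%E.

Definition is_flow (T : R) u X : Prop :=
  forall x, {within `[0, T], continuous (fun t => X t x)} /\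
    forall t, t \in `[0, T] -> forall i,
      component i (X t x) =
      component i x + \int[lebesgue_measure]_(s in `[0, t]) component i (u s (X s x)).

(* The inverse of X t, a bijection of the plane when X is the flow of a
   velocity field as above. *)
Definition flow_inv X (t : R) : R * R -> R * R := 'pinv_id setT (X t).

Definition radial_cutoff (a : R * R -> R) : Prop :=
  [/\ smooth a,
      forall x y, enorm x = enorm y -> a x = a y,
      forall x, 0 <= a x <= 1,
      forall x, 1 < enorm x -> a x = 0 &
      forall x, enorm x <= 2^-1 -> a x = 1].

Definition dilate (a : R * R -> R) (lambda : R) : R * R -> R :=
  fun x => a (lambda^-1 *: x).

Definition perp (x : R * R) : R * R := (- x.2, x.1).

Definition biot_savart (j : 'I_2) (x : R * R) : R :=
  (2 * pi)^-1 * component j (perp x) / enorm x ^+ 2.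

Definition near_kernel a lambda j : R * R -> R :=
  fun x => dilate a lambda x * biot_savart j x.

Definition far_kernel a lambda j : R * R -> R :=
  fun x => (1 - dilate a lambda x) * biot_savart j x.

Definition serfati_identity a (T : R) vin u : Prop :=
  forall lambda, 0 < lambda -> forall t, t \in `[0, T] ->
  forall j x,
    component j (u t x) - component j (vin x) =
    convolution (near_kernel a lambda j) (fun y => curl (u t) y - curl vin y) x
    - \int[lebesgue_measure]_(s in `[0, t])
        matrix_convolution (grad_gradperp (far_kernel a lambda j)) (tensor (u s) (u s)) x.

(* Vorticities are classes modulo null sets, so the transport identity is
   required almost everywhere and for each representative of the initial
   vorticity. *)
Definition vorticity_transport (T : R) vin u X : Prop :=
  forall w0, is_curl vin w0 -> forall t, t \in `[0, T] ->
    {ae leb2, forall x, curl (u t) x = w0 (flow_inv X t x)}.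

Definition euler_solution a h (T : R) vin u X : Prop :=
  [/\ in_CS h T u,
      u 0 = vin,
      is_flow T u X,
      vorticity_transport T vin u X &
      serfati_identity a T vin u].

Definition J_field a h X1 (w1 w2 : R * R -> R) (t : R) (x : R * R) : R * R :=
  let J j :=
    convolution (near_kernel a (h (enorm x)) j)
         (fun y => w1 (flow_inv X1 t y) - w2 (flow_inv X1 t y)) x
    - convolution (near_kernel a (h (enorm x)) j) (fun y => w1 y - w2 y) (X1 t x) in
  (J 0, J 1).

(* Space-time points are ordered (x, t): the product measure instance needs a
   sigma-finite instance on the right factor, inferable only for dimension 1. *)
Definition J_weighted_norm a h zeta (T : R) X1 w1 w2 : \bar R :=
  'N[leb2 \x lebesgue_measure]_+oo[
    ((fun p : (R * R) * R =>
       (enorm (J_field a h X1 w1 w2 p.2 p.1) / zeta (enorm p.1))%:E)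
     \_ (setT `*` `]0%R, T[))]%E.

Definition a_quantity a h zeta (T : R) (v1 v2 : R * R -> R * R) X1 w1 w2 : \bar R :=
  (weighted_norm zeta (fun x => v1 x - v2 x)%R
   + J_weighted_norm a h zeta T X1 w1 w2)%E.

End Serfati.

(* Main.v *)
Require Import Defs.
From HB Require Import structures.
From mathcomp Require Import all_boot all_order all_algebra.
From mathcomp Require Import all_classical all_reals all_analysis.
From mathcomp Require Import ess_sup_inf measurable_realfun ring lra.

Set Implicit Arguments.
Unset Strict Implicit.
Unset Printing Implicit Defensive.

Import Order.TTheory GRing.Theory Num.Theory.
Import numFieldNormedType.Exports HBNNSimple.

Local Open Scope classical_set_scope.
Local Open Scope ring_scope.

(** The first term of a(T) is part of the S_zeta norm, so all the work is to
bound J by the essential supremum M of the curl of u1^0 - u2^0.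

The kernel a_lambda K is supported in the ball of radius lambda and is
O(1/|x|), hence has L^1 norm O(lambda) on the plane. The convolution of it with
a function bounded by M is therefore at most a constant times lambda * M
(normr_convolution_near_kernel_le). With lambda = h(x), both convolutions in
J(t, x) are O(h(x) M), and h <= zeta gives |J|/zeta = O(M). The constant is
absolute because every cutoff a takes values in [0, 1] and is supported in the
unit ball.

What remains is that both densities, w1 - w2 and (w1 - w2) o X1^{-1}(t), are
bounded by M almost everywhere (transported_vorticity_diff_le). The first one
asks that two representatives of the same distributional curl agree almost
everywhere, and the second one that X1^{-1}(t) does not enlarge null sets. Both
follow from the transport identity, because it holds for every representative
of the initial vorticity: truncating the curl of u1^0 - u2^0 gives a
representative c with |c| <= M everywhere, and then w1 and c + w2 both represent
the curl of u1^0, so w1 o X1^{-1}(t) and (c + w2) o X1^{-1}(t) both agree almost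
everywhere with the curl of u1(t). Subtracting w2 o X1^{-1}(t) leaves
c o X1^{-1}(t), which is bounded by M at every point. The time t = 0, where the
flow is the identity, gives the first density.

The integral of an arbitrary function, measurable or not, is a difference of
suprema over simple functions, so that a measurable majorant bounds it
(normr_Rintegral_le_dom). This covers densities composed with X1^{-1}(t). *)

(** * Integrals and essential suprema of arbitrary functions *)

(** The integral of a nonnegative f is a supremum over simple functions below f.
Each of these is measurable and almost everywhere below g, which is why f itself
need not be measurable. *)
Lemma ge0_le_integral_ae_dom d (T : measurableType d) (R : realType)
    (mu : {measure set T -> \bar R}) (f g : T -> \bar R) :
  (forall x, 0 <= f x)%E -> (forall x, 0 <= g x)%E ->
  measurable_fun setT g -> {ae mu, forall x, (f x <= g x)%E} ->
  (\int[mu]_x f x <= \int[mu]_x g x)%E.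
Proof.
move=> f0 g0 mg fg.
rewrite ge0_integralTE//; apply/ge_ereal_sup => _ [h /= hf <-].
rewrite -integralT_nnsfun; apply: ae_ge0_le_integral => //.
- by move=> x _; rewrite lee_fin.
- by apply/measurable_EFinP.
- by apply: filterS fg => x fgx _; exact: le_trans (hf x) fgx.
Qed.

(** The bound B serves for the positive and the negative part alike, and the
difference of two numbers of [0, B] lies in [-B, B]. *)
Lemma normr_Rintegral_le_dom d (T : measurableType d) (R : realType)
    (mu : {measure set T -> \bar R}) (f : T -> R) (g : T -> \bar R) (B : R) :
  (forall x, 0 <= g x)%E -> measurable_fun setT g ->
  {ae mu, forall x, (`|f x|%:E <= g x)%E} -> (\int[mu]_x g x <= B%:E)%E ->
  `|\int[mu]_x f x| <= B.
Proof.
move=> g0 mg fg gB; rewrite /Rintegral integralE.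
have split_abs x : `|f x|%:E =
    ((EFin \o f)^\+ x + (EFin \o f)^\- x)%E.
  by rewrite -[LHS]/((abse \o (EFin \o f)) x) fune_abse.
have part (p : T -> \bar R) : (forall x, 0 <= p x)%E ->
    (forall x, (p x <= `|f x|%:E)%E) ->
    (0 <= \int[mu]_x p x)%E /\ (\int[mu]_x p x <= B%:E)%E.
  move=> p0 pf; split; first exact: integral_ge0.
  apply: le_trans gB; apply: ge0_le_integral_ae_dom => //.
  by apply: filterS fg => x; exact: le_trans (pf x).
have [||p0 pB] := part (EFin \o f)^\+%E.
- by move=> x; exact: funepos_ge0.
- by move=> x; rewrite split_abs leeDl ?funeneg_ge0.
have [||n0 nB] := part (EFin \o f)^\-%E.
- by move=> x; exact: funeneg_ge0.
- by move=> x; rewrite split_abs leeDr ?funepos_ge0.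
move: p0 pB n0 nB; rewrite /=.
case: (integral _ _ _) => [p| |]//; case: (integral _ _ _) => [n| |]//=.
rewrite !lee_fin => p0 pB n0 nB; rewrite ler_norml; lra.
Qed.

(** Stated for an abstract measurable type, these also apply to predicates on
R * R, where the filter structure is not inferred directly. *)
Lemma ae_imply d (T : measurableType d) (R : realType)
    (mu : {measure set T -> \bar R}) (P Q : T -> Prop) :
  (forall x, P x -> Q x) ->
  {ae mu, forall x, P x} -> {ae mu, forall x, Q x}.
Proof. exact: filterS. Qed.

Lemma ae_imply2 d (T : measurableType d) (R : realType)
    (mu : {measure set T -> \bar R}) (P Q S : T -> Prop) :
  (forall x, P x -> Q x -> S x) ->
  {ae mu, forall x, P x} -> {ae mu, forall x, Q x} -> {ae mu, forall x, S x}.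
Proof. exact: filterS2. Qed.

Section EssentialSup.
Context d (T : measurableType d) (R : realType) (mu : {measure set T -> \bar R}).

Lemma Lnormy_le (f : T -> \bar R) (B : \bar R) :
  (0 <= B)%E -> (forall x, `|f x| <= B)%E -> ('N[mu]_+oo[f] <= B)%E.
Proof.
move=> B0 fB; rewrite unlock; case: ifPn => // _.
by apply/ess_supP; exact: nearW.
Qed.

(** The norm is 0 by convention when mu is the zero measure, but then every
property holds almost everywhere. *)
Lemma ae_normr_le_Lnormy (f : T -> R) (M : R) :
  'N[mu]_+oo[EFin \o f]%E = M%:E -> {ae mu, forall x, `|f x| <= M}.
Proof.
rewrite unlock; case: ifPn => [_ fM|mu0 _].
  have := ess_sup_ge mu (abse \o (EFin \o f)).
  by rewrite fM; apply: ae_imply => x; rewrite /= lee_fin.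
exists setT; split => //; apply/eqP; rewrite eq_le measure_ge0 andbT.
by rewrite leNgt.
Qed.

End EssentialSup.

(** * Measurability and Lebesgue measure in the plane *)

(** An open set is the union of the squares with rational centre and radius that
it contains. Countably many rectangles are involved, so the union is in the
product sigma-algebra. *)
Lemma open_measurable_plane (R : realType) (U : set (R * R)) :
  open U -> measurable U.
Proof.
move=> oU.
pose box (q : rat * rat * rat) : set (R * R) :=
  ball (ratr q.1.1 : R) (ratr q.2) `*` ball (ratr q.1.2 : R) (ratr q.2).
have -> : U = \bigcup_q (if `[< box q `<=` U >] then box q else set0).
  apply/seteqP; split => [x Ux|x [q _]]; last by case: asboolP => // qU /qU.
  have /nbhs_ballP[e/= e0 xeU] : nbhs x U by exact: open_nbhs_nbhs.
  have [r] := rat_in_itvoo (divr_gt0 e0 (ltr0n R 2)).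
  rewrite in_itv/= => /andP[r0 re].
  (* Radius below e / 2: the square contains x, which is within r of its centre,
     and stays within 2 r < e of x. *)
  have near_rat (t : R) : exists p : rat, ball t (ratr r) (ratr p : R).
    have [p] : exists p : rat, ratr p \in `]t, t + ratr r[.
      by apply: rat_in_itvoo; rewrite ltrDl.
    rewrite in_itv/= => /andP[tp pr]; exists p.
    rewrite -ball_normE/= ltr_norml; apply/andP; split; lra.
  have [p xp] := near_rat x.1; have [q xq] := near_rat x.2.
  exists (p, q, r) => //.
  case: asboolP => [_|[]].
    by split; apply: ball_sym.
  move=> y [yp yq]; apply: xeU; split.
    by have := ball_triangle xp yp; apply: le_ball; lra.
  by have := ball_triangle xq yq; apply: le_ball; lra.
apply: countable_bigcupT_measurable => // q.
case: asboolP => // _.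
by apply: measurableX; apply: open_measurable; exact: ball_open.
Qed.

Lemma continuous_measurable_plane (R : realType) (f : R * R -> R) :
  continuous f -> measurable_fun setT f.
Proof.
move=> /continuousP cf; apply: (measurability _ (RGenOpens.measurableE R)).
move=> _ [_ [a [b ->] <-]]; rewrite setTI; apply: open_measurable_plane.
exact/cf/interval_open.
Qed.

Lemma lebesgue_square (R : realType) (x : R * R) (r : R) : 0 <= r ->
  leb2 (`[x.1 - r, x.1 + r]%classic `*` `[x.2 - r, x.2 + r]%classic)
  = ((2 * r) ^+ 2)%:E.
Proof.
move=> r0; rewrite product_measure1E//= !lebesgue_measure_itv/= !lte_fin.
have side (t : R) : (if (t - r < t + r)%R then (t + r)%R%:E - (t - r)%R%:E else 0)%E
    = (2 * r)%:E.
  case: ltP => rt; rewrite -?EFinB; congr EFin; lra.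
by rewrite !side -EFinM expr2.
Qed.

Section EuclideanNorm.
Variable R : realType.
Implicit Types z : R * R.

Lemma enorm_ge0 z : 0 <= enorm z.
Proof. exact: sqrtr_ge0. Qed.

Lemma normr_fst_le_enorm z : `|z.1| <= enorm z.
Proof. by rewrite -sqrtr_sqr ler_wsqrtr// lerDl sqr_ge0. Qed.

Lemma normr_snd_le_enorm z : `|z.2| <= enorm z.
Proof. by rewrite -sqrtr_sqr ler_wsqrtr// lerDr sqr_ge0. Qed.

Lemma enorm_le_sum z : enorm z <= `|z.1| + `|z.2|.
Proof.
rewrite -[leRHS]ger0_norm ?addr_ge0// -sqrtr_sqr ler_wsqrtr//.
rewrite -(real_normK (num_real z.1)) -(real_normK (num_real z.2)).
have := mulr_ge0 (normr_ge0 z.1) (normr_ge0 z.2); nra.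
Qed.

End EuclideanNorm.

(** * Mass of the truncated Biot-Savart kernel *)

Section KernelMass.
Variable R : realType.
Variables (lambda : R) (x : R * R).
Hypothesis lambda_gt0 : 0 < lambda.

Let radius (n : nat) : R := lambda / 2 ^+ n.

Let square n : set (R * R) :=
  `[x.1 - radius n, x.1 + radius n]%classic `*`
  `[x.2 - radius n, x.2 + radius n]%classic.

(** A multiple of the indicator of the square of radius lambda / 2^n around x,
summed over n. It dominates 1/|x - y| on the disc of radius lambda, and being a
sum of indicators it has an explicit integral. *)
Definition dyadic_majorant (y : R * R) : \bar R :=
  (\sum_(n <oo) ((2 ^+ n.+1 / lambda) * \1_(square n) y)%:E)%E.

Let radius_ge0 n : 0 <= radius n.
Proof. by rewrite divr_ge0 ?exprn_ge0 ?ltW. Qed.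

Let msquare n : measurable (square n).
Proof. by apply: measurableX; exact: measurable_itv. Qed.

Let term_ge0 n y : 0 <= 2 ^+ n.+1 / lambda * \1_(square n) y.
Proof.
rewrite mulr_ge0 ?indicE ?ler0n//.
by rewrite divr_ge0 ?exprn_ge0// ltW.
Qed.

Lemma dyadic_majorant_ge0 y : (0 <= dyadic_majorant y)%E.
Proof. by apply: nneseries_ge0 => n _ _; rewrite lee_fin. Qed.

Let mterm n : measurable_fun setT
  (fun y => (2 ^+ n.+1 / lambda * \1_(square n) y)%:E).
Proof. by apply/measurable_EFinP; apply: measurable_funM. Qed.

Lemma measurable_dyadic_majorant : measurable_fun setT dyadic_majorant.
Proof. by apply: ge0_emeasurable_sum => // n y _ _; rewrite lee_fin. Qed.

(** The n-th term has integral (2^(n+1) / lambda) * (2 lambda / 2^n)^2, that is,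
16 lambda / 2^(n+1). *)
Lemma integral_dyadic_majorant :
  (\int[leb2]_y dyadic_majorant y <= (16 * lambda)%:E)%E.
Proof.
rewrite integral_nneseries//; last by move=> n y _; rewrite lee_fin.
have termE n : (\int[leb2]_y (2 ^+ n.+1 / lambda * \1_(square n) y)%:E =
    (16 * lambda / (2 ^ (n + 1))%:R)%:E)%E.
  under eq_integral do rewrite EFinM.
  rewrite ge0_integralZl//=; last 2 first.
  - apply/measurable_EFinP; apply: measurable_indic; exact: msquare.
  - by rewrite lee_fin divr_ge0 ?exprn_ge0 ?ltW.
  have -> : (\int[leb2]_y (\1_(square n) y)%:E = ((2 * radius n) ^+ 2)%:E)%E.
    rewrite -(lebesgue_square x (radius_ge0 n)) integral_indic//.
      by congr (leb2 _); exact: setIT.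
    exact: msquare.
  rewrite -EFinM; congr EFin.
  rewrite /radius natrX addn1 !exprS; field.
  by rewrite expf_neq0 ?gt_eqF.
under eq_eseriesr do rewrite termE.
have := @cvg_geometric_eseries_half R (16 * lambda) 0.
by rewrite expr0 divr1 => /cvg_lim ->.
Qed.

(** The term of the dyadic scale n given by
lambda / 2^(n+1) < |x - y| <= lambda / 2^n already suffices. *)
Lemma inv_enorm_le_dyadic_majorant y :
  0 < enorm (x - y) <= lambda -> ((enorm (x - y))^-1%:E <= dyadic_majorant y)%E.
Proof.
set m := enorm _ => /andP[m0 ml].
have ex_small : exists k, radius k < m.
  exists (Num.bound (lambda / m)); rewrite ltr_pdivrMr ?exprn_gt0//.
  rewrite mulrC -ltr_pdivrMr//.
  apply: lt_trans (archi_boundP (divr_ge0 (ltW lambda_gt0) (ltW m0))) _.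
  by rewrite -natrX ltr_nat ltn_expl.
case: (ex_minnP ex_small) => -[|n] mn nmin.
  by move: mn; rewrite /radius expr0 divr1 ltNge ml.
have mrn : m <= radius n.
  by rewrite leNgt; apply/negP => /nmin; rewrite ltnn.
apply: le_trans (nneseries_lim_ge n.+1 _); last first.
  by move=> k _ _; rewrite lee_fin.
rewrite big_nat_recr//=.
have -> : \1_(square n) y = 1 :> R.
  rewrite indicE mem_set//; split => /=; rewrite in_itv/=.
    have := le_trans (normr_fst_le_enorm (x - y)) mrn.
    rewrite ler_norml/= => /andP[? ?]; apply/andP; split; lra.
  have := le_trans (normr_snd_le_enorm (x - y)) mrn.
  rewrite ler_norml/= => /andP[? ?]; apply/andP; split; lra.
rewrite mulr1; apply: le_trans (leeDr _ _) => /=.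
  rewrite lee_fin -[leRHS]invf_div lef_pV2 ?posrE ?divr_gt0 ?exprn_gt0//.
  exact: ltW.
by apply: sume_ge0 => k _; rewrite lee_fin.
Qed.

End KernelMass.

Section NearKernel.
Variable R : realType.
Implicit Types (a : R * R -> R) (j : 'I_2).

(** At the origin both sides vanish, since 0^-1 = 0. *)
Lemma normr_biot_savart_le j (z : R * R) :
  `|biot_savart j z| <= (enorm z)^-1.
Proof.
have [z0|z0] := eqVneq (enorm z) 0.
  by rewrite /biot_savart z0 expr0n invr0 mulr0 normr0.
have z_gt0 : 0 < enorm z by rewrite lt_neqAle eq_sym z0 enorm_ge0.
have comp_le : `|component j (perp z)| <= enorm z.
  by rewrite /component/=; case: ifP => _; rewrite ?normrN
    ?normr_fst_le_enorm ?normr_snd_le_enorm.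
rewrite /biot_savart normrM normrM !normfV normrX (ger0_norm (enorm_ge0 z)).
rewrite ler_pdivrMr ?exprn_gt0// exprS expr1 mulKf//.
apply: le_trans comp_le; rewrite ler_piMl//.
rewrite invf_le1 ?normr_gt0 ?mulf_neq0 ?gt_eqF ?pi_gt0//.
by have pi2 := pi_ge2 R; rewrite ger0_norm; lra.
Qed.

Lemma normr_near_kernel_le a lambda j (x y : R * R) :
  radial_cutoff a -> 0 < lambda ->
  (`|near_kernel a lambda j (x - y)|%:E <= dyadic_majorant lambda x y)%E.
Proof.
move=> [_ _ a01 asupp _] l0.
have [far|near] := ltP lambda (enorm (x - y)).
  rewrite /near_kernel /dilate asupp ?mul0r ?normr0 ?dyadic_majorant_ge0//.
  rewrite /enorm/= !exprMn -mulrDr sqrtrM ?sqr_ge0// sqrtr_sqr.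
  by rewrite gtr0_norm ?invr_gt0// mulrC ltr_pdivlMr ?mul1r.
have le_inv : `|near_kernel a lambda j (x - y)| <= (enorm (x - y))^-1.
  rewrite normrM; apply: le_trans (normr_biot_savart_le j _).
  have /andP[a0 a1] := a01 (lambda^-1 *: (x - y)).
  by rewrite ler_piMl// /dilate ger0_norm.
have [z0|z0] := eqVneq (enorm (x - y)) 0.
  apply: le_trans (dyadic_majorant_ge0 x l0 y).
  by rewrite lee_fin (le_trans le_inv)// z0 invr0.
apply: (@le_trans _ _ (enorm (x - y))^-1%:E); first by rewrite lee_fin.
apply: inv_enorm_le_dyadic_majorant => //.
by rewrite lt_neqAle eq_sym z0 enorm_ge0.
Qed.

(** Young's inequality for L^1 * L^oo. The density g is arbitrary, because it
will be a vorticity composed with the inverse of a flow. *)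
Lemma normr_convolution_near_kernel_le a lambda j (g : R * R -> R) (M : R)
    (x : R * R) :
  radial_cutoff a -> 0 < lambda -> 0 <= M ->
  {ae leb2, forall y, `|g y| <= M} ->
  `|convolution (near_kernel a lambda j) g x| <= 16 * lambda * M.
Proof.
move=> ac l0 M0 gM; rewrite /convolution.
apply (@normr_Rintegral_le_dom _ _ R leb2
  (fun y : R * R => near_kernel a lambda j (x - y) * g y)
  (fun y => M%:E * dyadic_majorant lambda x y)%E).
- by move=> y; rewrite mule_ge0 ?lee_fin ?dyadic_majorant_ge0.
- by apply: measurable_funeM; exact: measurable_dyadic_majorant.
- apply: (ae_imply _ gM) => y gyM; rewrite normrM mulrC EFinM.
  by apply: lee_pmul; rewrite ?lee_fin// normr_near_kernel_le.
- rewrite ge0_integralZl//; last 2 first.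
  + exact: measurable_dyadic_majorant.
  + by move=> y _; exact: dyadic_majorant_ge0.
  rewrite mulrC EFinM; apply: lee_wpmul2l; first by rewrite lee_fin.
  exact: integral_dyadic_majorant.
Qed.

End NearKernel.

(** * Distributional curl *)

Section Discs.
Variable R : realType.
Implicit Types (f g : R * R -> R) (r : R).

Definition disc r : set (R * R) := [set x | enorm x <= r].

Lemma continuous_enorm : continuous (@enorm R).
Proof.
move=> x; apply: continuous_comp; last exact: sqrt_continuous.
by apply: cvgD; rewrite !expr2; apply: cvgM; (exact: cvg_fst || exact: cvg_snd).
Qed.

Lemma measurable_disc r : measurable (disc r).
Proof.
have mC : measurable (~` disc r).
  apply: open_measurable_plane.
  have -> : ~` disc r = (@enorm R) @^-1` `]r, +oo[%classic.
    by apply/seteqP; split => x /=; rewrite /disc/= in_itv/= andbT ltNge => /negP.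
  by apply: open_comp => // x _; exact: continuous_enorm.
by rewrite -(setCK (disc r)); exact: measurableC.
Qed.

Let box r : set (R * R) :=
  `[0 - `|r|, 0 + `|r|]%classic `*` `[0 - `|r|, 0 + `|r|]%classic.

Let disc_sub_box r : disc r `<=` box r.
Proof.
move=> x xr; have xr' := le_trans xr (ler_norm r).
have := le_trans (normr_fst_le_enorm x) xr'.
have := le_trans (normr_snd_le_enorm x) xr'.
rewrite /box !ler_norml => /andP[a b] /andP[c d].
by split; rewrite /= in_itv/= sub0r add0r ?a ?b ?c ?d.
Qed.

Lemma lebesgue_disc_fin r : (leb2 (disc r) < +oo)%E.
Proof.
apply: (@le_lt_trans _ _ (leb2 (box r))).
  apply: le_measure; rewrite ?inE; [exact: measurable_disc| |exact: disc_sub_box].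
  by apply: measurableX; exact: measurable_itv.
have := @lebesgue_square R (0, 0) `|r| (normr_ge0 r).
by rewrite /box => ->; rewrite ltry.
Qed.

Lemma continuous_bounded_disc f r :
  continuous f -> [bounded f x | x in disc r].
Proof.
move=> cf.
have : bounded_set (f @` box r).
  apply/compact_bounded/continuous_compact.
    exact/continuous_subspaceT.
  by apply: compact_setX; exact: segment_compact.
move=> [M [Mreal fM]]; exists M; split=> // N MN x xr.
by apply: (fM _ MN); exists x => //; exact: disc_sub_box xr.
Qed.

Lemma continuous_integrable_disc f r :
  continuous f -> leb2.-integrable (disc r) (EFin \o f).
Proof.
move=> cf.
apply (@measurable_bounded_integrable _ _ _ leb2 f _ (measurable_disc r)
  (lebesgue_disc_fin r)).
- by apply: measurable_funTS; exact: continuous_measurable_plane.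
- exact: continuous_bounded_disc.
Qed.

(** This gives the integrability of each product in the definition of the
distributional curl, hence the right to split these integrals. *)
Lemma integrable_mul_compact_support f g r :
  leb2.-integrable (disc r) (EFin \o f) -> continuous g ->
  (forall x, r < enorm x -> g x = 0) ->
  leb2.-integrable setT (EFin \o (fun x => f x * g x)).
Proof.
move=> fi cg g0.
have fgi : leb2.-integrable (disc r) (EFin \o (fun x => f x * g x)).
  apply (@integrableMl _ _ _ leb2 _ (measurable_disc r) _ _ fi).
    by apply: measurable_funTS; exact: continuous_measurable_plane.
  exact: continuous_bounded_disc.
have := (@integrable_mkcond _ _ _ leb2 _ (EFin \o (fun x => f x * g x))
  (measurable_disc r)).1 fgi.
congr (integrable _ _ _); apply/funext => x; rewrite patchE /=.
case: ifPn => //; rewrite notin_setE /disc/= => /negP; rewrite -ltNge => rx.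
by rewrite g0 ?mulr0.
Qed.

End Discs.

Section TestFunctions.
Variable R : realType.
Implicit Types (phi : R * R -> R) (i : 'I_2).

Lemma test_function_continuous phi : test_function phi -> continuous phi.
Proof. by case=> /(_ 0%N). Qed.

Lemma test_function_continuous_partial phi i :
  test_function phi -> continuous (partial i phi).
Proof. by case=> /(_ 1%N) /(_ i) []. Qed.

Lemma partial_eq0 phi (r : R) i x :
  (forall y, r < enorm y -> phi y = 0) -> r < enorm x -> partial i phi x = 0.
Proof.
move=> phi0 rx; rewrite /partial (@near_eq_derive _ _ _ _ (cst 0)) ?derive_cst//.
have : \forall y \near x, r < enorm y.
  exact: (cvgr_gt _ (@continuous_enorm R x)).
by apply: filterS.
Qed.

End TestFunctions.

Section Curl.
Variable R : realType.
Implicit Types (v : R * R -> R * R) (w : R * R -> R).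

(** Continuity of the fields makes them locally integrable; without it the
integrals against test functions would not be additive. *)
Lemma is_curl_linear v1 v2 w1 w2 (k : R) : continuous v1 -> continuous v2 ->
  is_curl v1 w1 -> is_curl v2 w2 ->
  is_curl (fun x => v1 x + k *: v2 x) (fun x => w1 x + k * w2 x).
Proof.
move=> cv1 cv2 [mw1 iw1 w1P] [mw2 iw2 w2P]; split.
- by apply: measurable_funD => //; apply: measurable_funM.
- move=> r; have md := measurable_disc r.
  exact (@integrableD _ _ _ leb2 _ md _ _ (iw1 r)
    (@integrableZl _ _ _ leb2 _ md k _ (iw2 r))).
move=> phi tphi; have [_ [r phi0]] := tphi.
have cphi := test_function_continuous tphi.
have cdphi i : continuous (partial i phi).
  exact: test_function_continuous_partial.
have dphi0 i x : r < enorm x -> partial i phi x = 0 by exact: partial_eq0.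
have iw w : is_curl v1 w \/ is_curl v2 w ->
    leb2.-integrable setT (EFin \o (fun x => w x * phi x)).
  by move=> [] [_ iw _]; exact: (integrable_mul_compact_support (iw r) cphi phi0).
have iv v : continuous v -> leb2.-integrable setT
    (EFin \o (fun x => (v x).1 * partial 1 phi x - (v x).2 * partial 0 phi x)).
  move=> cv.
  have c1 : continuous (fun x => (v x).1).
    by move=> x; apply: cvg_comp (cv x) _; exact: cvg_fst.
  have c2 : continuous (fun x => (v x).2).
    by move=> x; apply: cvg_comp (cv x) _; exact: cvg_snd.
  have i1 := integrable_mul_compact_support (continuous_integrable_disc r c1)
    (cdphi 1) (dphi0 1).
  have i2 := integrable_mul_compact_support (continuous_integrable_disc r c2)
    (cdphi 0) (dphi0 0).
  exact (@integrableB _ _ _ leb2 _ measurableT _ _ i1 i2).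
have lin (f g : R * R -> R) : leb2.-integrable setT (EFin \o f) ->
    leb2.-integrable setT (EFin \o g) ->
    \int[leb2]_x (f x + k * g x) = \int[leb2]_x f x + k * \int[leb2]_x g x.
  move=> fi gi; rewrite RintegralD// ?RintegralZl//.
  exact (@integrableZl _ _ _ leb2 _ measurableT k _ gi).
transitivity (\int[leb2]_x (w1 x * phi x + k * (w2 x * phi x))).
  by apply: eq_Rintegral => x _; ring.
rewrite lin; [|by apply: iw; left|by apply: iw; right].
rewrite w1P// w2P// -lin; [|exact: iv|exact: iv].
apply: eq_Rintegral => x _.
have -> : (v1 x + k *: v2 x).1 = (v1 x).1 + k * (v2 x).1 by [].
have -> : (v1 x + k *: v2 x).2 = (v1 x).2 + k * (v2 x).2 by [].
ring.
Qed.

(** Clipping to [-M, M] changes w on a null set only, so the integrals against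
test functions stay the same. The point is to get a bound at every point, which
survives composition with any map. *)
Lemma is_curl_truncate v w (M : R) : 0 <= M -> is_curl v w ->
  {ae leb2, forall x, `|w x| <= M} ->
  exists2 c, is_curl v c & forall x, `|c x| <= M.
Proof.
move=> M0 [mw iw wP] wM.
pose c x := Num.max (- M) (Num.min (w x) M).
have c_id x : `|w x| <= M -> c x = w x.
  by rewrite ler_norml => /andP[? ?]; rewrite /c min_l// max_r.
have cw x : `|c x| <= `|w x|.
  have w0 := normr_ge0 (w x).
  rewrite ler_norml /c le_max le_min ge_max ge_min ler_norm.
  rewrite (lerNnormlW (lexx `|w x|)) /=.
  by apply/andP; split; [apply/orP; right|]; lra.
have mc : measurable_fun setT c.
  by apply: measurable_maxr => //; apply: measurable_minr.
exists c; last first.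
  move=> x; rewrite ler_norml /c le_max lexx ge_max ge_min lexx orbT andbT/=.
  lra.
split => // [r|phi tphi].
  have := iw r; apply: le_integrable.
  - exact: measurable_disc.
  - by apply/measurable_EFinP; exact: measurable_funTS.
  - by move=> x _; rewrite /= lee_fin.
rewrite -wP//; congr fine.
have mphi := continuous_measurable_plane (test_function_continuous tphi).
apply: (@ae_eq_integral _ _ _ leb2 _ (EFin \o (fun x => w x * phi x))
  (EFin \o (fun x => c x * phi x)) measurableT).
- by apply/measurable_EFinP; apply: measurable_funM.
- by apply/measurable_EFinP; apply: measurable_funM.
- by apply: (ae_imply _ wM) => x wxM _ /=; rewrite c_id.
Qed.

End Curl.

(** * Vorticity transported by the flow *)

Section Flow.
Variable R : realType.
Implicit Types u X : R -> R * R -> R * R.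

Lemma flow0 (T : R) u X : 0 <= T -> is_flow T u X -> X 0 = id.
Proof.
move=> T0 flowX; apply/funext => x.
have [_ /(_ 0)] := flowX x; rewrite in_itv/= lexx T0 => /(_ isT) eqX.
have comp i : component i (X 0 x) = component i x.
  by rewrite eqX set_itv1 Rintegral_set1 addr0.
have := comp 0; have := comp 1.
case: (X 0 x) => p q; case: x {eqX comp} => p' q'.
by rewrite /component/= => -> ->.
Qed.

Lemma flow_inv0 (T : R) u X : 0 <= T -> is_flow T u X -> flow_inv X 0 = id.
Proof.
move=> T0 /(flow0 T0) X0; apply/funext => x; rewrite /flow_inv X0.
by apply: (@pinvKV _ _ (fun y => y) setT id) => //; rewrite inE.
Qed.

(** With c a representative of the curl of v1 - v2 bounded by M at every point,
w1 and c + w2 are two representatives of the curl of v1. The transport identity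
makes them agree almost everywhere after composition with the inverse flow, so
w1 - w2 and c agree there too. *)
Lemma transported_vorticity_diff_le (T t M : R) u X (v1 v2 : R * R -> R * R)
    (w1 w2 : R * R -> R) :
  continuous v1 -> continuous v2 -> is_curl v1 w1 -> is_curl v2 w2 ->
  vorticity_transport T v1 u X -> t \in `[0, T] ->
  'N[leb2]_+oo[EFin \o curl (fun x => v1 x - v2 x)%R]%E = M%:E ->
  {ae leb2, forall y, `|w1 (flow_inv X t y) - w2 (flow_inv X t y)| <= M}.
Proof.
move=> cv1 cv2 cw1 cw2 transp t0T normM.
have M0 : 0 <= M by rewrite -lee_fin -normM Lnorm_ge0.
have cdiff : is_curl (fun x => v1 x - v2 x) (curl (fun x => v1 x - v2 x)).
  apply: (@xgetPex _ _ [set w | is_curl (fun x => v1 x - v2 x) w]).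
  exists (fun x => w1 x + -1 * w2 x).
  have -> : (fun x => v1 x - v2 x) = (fun x => v1 x + -1 *: v2 x).
    by apply/funext => x; rewrite scaleN1r.
  exact: is_curl_linear.
have [c cc cM] := is_curl_truncate M0 cdiff (ae_normr_le_Lnormy normM).
have cw1' : is_curl v1 (fun x => c x + 1 * w2 x).
  have {1}-> : v1 = (fun x => (v1 x - v2 x) + 1 *: v2 x).
    by apply/funext => x; rewrite scale1r subrK.
  apply: is_curl_linear => // x.
  by apply: cvgB; [exact: cv1|exact: cv2].
apply: ae_imply2 (transp _ cw1 t t0T) (transp _ cw1' t t0T) => y -> ->.
by rewrite mul1r addrK.
Qed.

End Flow.

Theorem theorem1p9 (R : realType) :
  exists C : R, 0 < C /\
  forall (a : R * R -> R) (T : R) (h zeta : R -> R)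
    (u10 u20 : R * R -> R * R) (w10 w20 : R * R -> R)
    (u1 u2 X1 X2 : R -> R * R -> R * R),
    radial_cutoff a ->
    0 < T ->
    wp_growth_bound h ->
    growth_bound zeta ->
    (forall r, 0 <= r -> h r <= zeta r) ->
    growth_bound (fun r => zeta r / h r) ->
    growth_bound (fun r => zeta r * h r) ->
    in_S h u10 -> in_S h u20 ->
    is_curl u10 w10 -> is_curl u20 w20 ->
    euler_solution a h T u10 u1 X1 ->
    euler_solution a h T u20 u2 X2 ->
    (a_quantity a h zeta T u10 u20 X1 w10 w20
     <= C%:E * S_norm zeta (fun x => u10 x - u20 x)%R)%E.
Proof.
(* Two components, two convolutions each, with 16 h(x) M for each of them. *)
exists 64; split => // a T h zeta u10 u20 w10 w20 u1 u2 X1 X2 ac T0.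
move=> [[[h_gt0 _ _ _ _] _] _] _ h_le_zeta _ _ [cu10 _ _ _] [cu20 _ _ _] cw1 cw2.
move=> [_ _ flowX transp _] _; rewrite /a_quantity /S_norm.
set W := weighted_norm _ _; have W0 : (0 <= W)%E by exact: Lnorm_ge0.
case normM : ('N[leb2]_+oo[EFin \o curl (fun x => u10 x - u20 x)%R])%E
  => [M| |]; last first.
- by have := Lnorm_ge0 leb2 +oo%E (EFin \o curl (fun x => u10 x - u20 x)%R);
    rewrite normM.
- by rewrite addey ?gt_eqF ?(lt_le_trans _ W0)// gt0_muley ?lte_fin// leey.
have M0 : 0 <= M by rewrite -lee_fin -normM Lnorm_ge0.
have bound t : t \in `[0, T] ->
    {ae leb2, forall y, `|w10 (flow_inv X1 t y) - w20 (flow_inv X1 t y)| <= M}.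
  by move=> t0T; exact: (transported_vorticity_diff_le cu10 cu20 cw1 cw2 transp).
have bound0 : {ae leb2, forall y, `|w10 y - w20 y| <= M}.
  have := bound 0; rewrite (flow_inv0 (ltW T0) flowX); apply.
  by rewrite in_itv/= lexx ltW.
have J_le t x : t \in `[0, T] ->
    enorm (J_field a h X1 w10 w20 t x) <= 64 * M * h (enorm x).
  move=> t0T; apply: le_trans (enorm_le_sum _) _ => /=.
  have hx := h_gt0 _ (enorm_ge0 x).
  have near j := normr_convolution_near_kernel_le j x ac hx M0 (bound t t0T).
  have far j := normr_convolution_near_kernel_le j (X1 t x) ac hx M0 bound0.
  have J_comp j := le_trans (ler_normB _ _) (lerD (near j) (far j)).
  have := lerD (J_comp 0) (J_comp 1); lra.
have JM : (J_weighted_norm a h zeta T X1 w10 w20 <= (64 * M)%:E)%E.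
  apply: Lnormy_le => [|[x t]]; first by rewrite lee_fin mulr_ge0.
  rewrite patchE; case: ifPn => [|_]; last by rewrite abse0 lee_fin mulr_ge0.
  rewrite inE/= in_itv/= => -[_ /andP[t0 tT]].
  have hx := h_gt0 _ (enorm_ge0 x); have hz := h_le_zeta _ (enorm_ge0 x).
  have zx := lt_le_trans hx hz.
  rewrite lee_fin ger0_norm ?divr_ge0 ?enorm_ge0 ?(ltW zx)//.
  rewrite ler_pdivrMr//; apply: le_trans (J_le t x _) _.
    by rewrite in_itv/= !ltW.
  by rewrite ler_wpM2l// mulr_ge0.
rewrite ge0_muleDr//.
apply: leeD; last by rewrite -EFinM.
by rewrite lee_pemull// lee_fin ler1n.
Qed.
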